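(* Let $n\ge 3$ and let $D_{2n}=\langle a,b: a^n=b^2=e,\ ab=ba^{-1}\rangle$ be the dihedral group of order $2n$, and let $\mathbb{Z}_n$ be the cyclic group of order $n$. Then the characteristic polynomial of the distance matrix of the power graph of $D_{2n}$ is \[ \phi_D(\mathcal{P}(D_{2n}),x) = (x+2)^{n-1}\Big(\big((4n+1)x+2(n+1)\big)\phi_D( \mathcal{P}(\mathbb{Z}_n),x)-n(2x+1)^2\, \phi_D( \mathcal{P}^*(\mathbb{Z}_n),x)\Big). \]
   Context: For a group $G$, the power graph $\mathcal{P}(G)$ is the simple graph with vertex set $G$ in which distinct $a,b$ are adjacent if and only if $a=b^k$ or $b=a^k$ for some positive integer $k$. The proper power graph $\mathcal{P}^*(G)$ is the subgraph of $\mathcal{P}(G)$ induced on $G\setminus\{e\}$, where $e$ is the identity. The distance matrix of a connected graph has $(u,v)$-entry equal to the graph distance $d(u,v)$ (and $0$ on the diagonal), and $\phi_D(\Gamma,x)=\det(xI-D(\Gamma))$ denotes the characteristic polynomial of the distance matrix $D(\Gamma)$ of $\Gamma$. *)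

(* Defs.v *)
From mathcomp Require Import all_boot all_order all_algebra all_fingroup all_solvable.
From mathcomp Require Import boolp.

Set Implicit Arguments.
Unset Strict Implicit.
Unset Printing Implicit Defensive.

Import GRing.Theory.

(* A finite simple graph with vertices in an ambient finite type T: its edges
   are the pairs related by adj whose two ends lie in vert. *)
Record sgraph (T : finType) := SGraph {
  vert : {set T};
  adj : rel T;
  adj_sym : symmetric adj;
  adj_irr : irreflexive adj
}.

Definition induced (T : finType) (Gam : sgraph T) (U : {set T}) : sgraph T :=
  SGraph (vert Gam :&: U) (@adj_sym T Gam) (@adj_irr T Gam).

Definition has_walk (T : finType) (Gam : sgraph T) (u v : T) (k : nat) : bool :=
  [exists p : k.-tuple T,
    [&& all [in vert Gam] (u :: p), path (adj Gam) u p & last u p == v]].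

(* Junk value 0 when u and v are not joined by a walk. *)
Definition gdist (T : finType) (Gam : sgraph T) (u v : T) : nat :=
  if pselect (exists k, has_walk Gam u v k) is left uv then ex_minn uv else 0.

Definition distance_mx (T : finType) (Gam : sgraph T) : 'M[int]_#|vert Gam| :=
  \matrix_(i, j) Posz (gdist Gam (enum_val i) (enum_val j)).

Definition distance_char_poly (T : finType) (Gam : sgraph T) : {poly int} :=
  char_poly (distance_mx Gam).

Section PowerGraph.
Local Open Scope group_scope.

Definition power_adj (gT : finGroupType) : rel gT := fun a b =>
  `[< a <> b /\ ((exists k : nat, 0 < k /\ a = b ^+ k) \/
                 (exists k : nat, 0 < k /\ b = a ^+ k)) >].

Lemma power_adj_sym (gT : finGroupType) : symmetric (@power_adj gT).
Proof.
move=> a b; rewrite /power_adj; apply: asbool_equiv_eq.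
by split=> -[ab [k_ab | k_ba]]; split; auto.
Qed.

Lemma power_adj_irr (gT : finGroupType) : irreflexive (@power_adj gT).
Proof. by move=> a; apply/asboolP => -[]. Qed.

Definition power_graph (gT : finGroupType) (G : {group gT}) : sgraph gT :=
  SGraph G (@power_adj_sym gT) (@power_adj_irr gT).

Definition proper_power_graph (gT : finGroupType) (G : {group gT}) : sgraph gT :=
  induced (power_graph G) (G :\ 1).

End PowerGraph.

(* Main.v *)
(* In [P(D_2n)] the rotations induce [P(Z_n)], with the same distances, and each
   reflection is a pendant vertex attached to the identity, which is adjacent to
   everything.  In [x I - D], subtracting twice the column of the identity from
   the columns of the reflections makes the reflection block equal to
   [(x + 2) I]; clearing the block above it alters only the identity row of
   [x I - D(P(Z_n))], and multilinearity of the determinant in that row produces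
   [phi (P(Z_n))] and the minor without the identity.  That minor is
   [phi (P^*(Z_n))], since a generator keeps [P^*(Z_n)] at the distances of
   [P(Z_n)]. *)
Require Import Defs.
From mathcomp Require Import all_boot all_order all_algebra all_fingroup all_solvable.
From mathcomp Require Import boolp ring.

Set Implicit Arguments.
Unset Strict Implicit.
Unset Printing Implicit Defensive.

Import GRing.Theory.

(** * Distances in graphs of diameter at most two *)

(** A common neighbour gives a walk of length two, and a walk of length zero or one forces equality
    or adjacency. *)
Lemma gdist_diameter2 (T : finType) (Gam : sgraph T) (u v : T) :
    u \in vert Gam -> v \in vert Gam ->
    (u != v -> ~~ adj Gam u v ->
      exists2 w, w \in vert Gam & adj Gam u w && adj Gam w v) ->
  gdist Gam u v = (if u == v then 0 else if adj Gam u v then 1 else 2)%N.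
Proof.
move=> uV vV uwv; set d := (RHS).
have walk_d : has_walk Gam u v d.
  rewrite /d; case: (eqVneq u v) uwv => [<- _|uv uwv].
    by apply/existsP; exists [tuple]; rewrite /= uV eqxx.
  have [auv|nauv] := boolP (adj Gam u v).
    by apply/existsP; exists [tuple v]; rewrite /= uV vV auv eqxx.
  have [w wV /andP[auw awv]] := uwv isT nauv.
  by apply/existsP; exists [tuple w; v]; rewrite /= uV vV wV auw awv eqxx.
have walk_ge k : has_walk Gam u v k -> (d <= k)%N.
  rewrite /d; case: (eqVneq u v) => [//|uv].
  case: k => [|[|k]] /existsP[p].
  - by rewrite tuple0 /= (negPf uv) andbF.
  - case/tupleP: p => w p; rewrite tuple0 /= => /and3P[_ + /eqP wv].
    by rewrite wv andbT => ->.
  - by move=> _; case: ifP.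
rewrite /gdist; case: pselect => [uv|[]]; last by exists d.
case: ex_minnP => k walk_k k_min.
by apply/eqP; rewrite eqn_leq k_min // walk_ge.
Qed.

(** * Adjacency and distance in power graphs *)

Section PowerAdjacency.
Local Open Scope group_scope.

Lemma power_adj_expg (gT : finGroupType) (x : gT) (k : nat) :
  0 < k -> x ^+ k != x -> power_adj x (x ^+ k).
Proof.
move=> k_gt0 xk; apply/asboolP; split; first by apply/eqP; rewrite eq_sym.
by right; exists k.
Qed.

Lemma power_adj1 (gT : finGroupType) (x : gT) : x != 1 -> power_adj x 1.
Proof.
(* The exponent must be positive, so [1] is written as [x ^+ #[x]] rather than [x ^+ 0]. *)
move=> x1; rewrite -(expg_order x) power_adj_expg ?order_gt0 ?expg_order //.
by rewrite eq_sym.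
Qed.

(** Equality of powers depends only on the exponents modulo the order. This carries adjacency from
    [Z] to the rotations without building an isomorphism. *)
Lemma power_adj_same_order (gT hT : finGroupType) (a : gT) (z : hT)
    (i j : nat) :
  #[a] = #[z] -> power_adj (a ^+ i) (a ^+ j) = power_adj (z ^+ i) (z ^+ j).
Proof.
move=> oaz.
have eq_az p q : (a ^+ p = a ^+ q) <-> (z ^+ p = z ^+ q).
  by split=> /eqP pq; apply/eqP; move: pq; rewrite !eq_expg_mod_order oaz.
by apply: asbool_equiv_eq; split=> -[ij ijk]; split; try (by move/eq_az);
  case: ijk => -[k [k_gt0]]; rewrite -expgM => /eq_az; rewrite expgM;
  [left | right | left | right]; exists k.
Qed.

Lemma power_adj_involution (gT : finGroupType) (s v : gT) :
  s ^+ 2 = 1 -> s != v -> s \notin <[v]> -> power_adj s v = (v == 1).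
Proof.
move=> s2 sv s_v; have [->|v1] := eqVneq v 1.
  by apply: power_adj1; apply: contraNneq s_v => ->; rewrite group1.
apply/asboolP => -[_ [] [k [_ eqk]]].
  by rewrite eqk mem_cycle in s_v.
(* Here [v = s ^+ k]: an even [k] gives [v = 1] and an odd [k] gives [v = s], both excluded. *)
move: v1 sv; rewrite {v s_v}eqk -(odd_double_half k) -mul2n expgD expgM s2.
by rewrite expg1n mulg1; case: (odd k); rewrite ?expg1 eqxx.
Qed.

(** The identity is the common neighbour. The value does not depend on [G], so distances can be
    compared across groups. *)
Lemma gdist_power_graph (gT : finGroupType) (G : {group gT}) (u v : gT) :
    u \in G -> v \in G ->
  gdist (power_graph G) u v
    = (if u == v then 0 else if power_adj u v then 1 else 2)%N.
Proof.
move=> uG vG; apply: gdist_diameter2 => //= uv nuv; exists 1.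
  exact: group1.
have u1 : u != 1.
  apply: contraNneq nuv => u1; rewrite power_adj_sym u1 power_adj1 //.
  by rewrite -u1 eq_sym.
have v1 : v != 1 by apply: contraNneq nuv => v1; rewrite v1 power_adj1 // -v1.
by rewrite power_adj1 // power_adj_sym power_adj1.
Qed.

Lemma gdist_power_graphC (gT : finGroupType) (G : {group gT}) (u v : gT) :
  u \in G -> v \in G -> gdist (power_graph G) u v = gdist (power_graph G) v u.
Proof. by move=> uG vG; rewrite !gdist_power_graph // eq_sym power_adj_sym. Qed.

(** Once the identity is removed, a generator takes over as common neighbour, since every other
    element is a positive power of it. *)
Lemma gdist_proper_power_graph (gT : finGroupType) (G : {group gT}) (u v : gT) :
    cyclic G -> u \in G :\ 1 -> v \in G :\ 1 ->
  gdist (proper_power_graph G) u v = gdist (power_graph G) u v.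
Proof.
move=> /cyclicP[z defG]; rewrite !inE => /andP[u1 uG] /andP[v1 vG].
rewrite gdist_power_graph //; apply: gdist_diameter2;
  rewrite ?inE ?u1 ?uG ?v1 ?vG //=.
have adj_z w : w != 1 -> w \in G -> w != z -> power_adj z w.
  rewrite defG => w1 /cycleP[i wi] wz; rewrite wi power_adj_expg -?wi //.
  by case: i wi w1 => // ->; rewrite expg0 eqxx.
move=> uv nuv; exists z.
  rewrite !inE {2}defG cycle_id andbT -cycle_eq1 -defG.
  have -> : (G :!=: 1) by apply: contraNneq u1 => G1; rewrite G1 inE in uG.
  by rewrite defG cycle_id.
have uz : u != z.
  by apply: contraNneq nuv => uz; rewrite uz adj_z // -uz eq_sym.
have vz : v != z.
  by apply: contraNneq nuv => vz; rewrite power_adj_sym vz adj_z // -vz.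
by rewrite power_adj_sym !adj_z.
Qed.

(** * The dihedral group recovered from its presentation *)

(** The relations give [D = <[a]> * <[b]>], of order at most [2n]. Conversely ['D_n.*2] satisfies
    them, hence is an image of [D]. Equality then holds in every bound. *)
Lemma dihedral_generators (n : nat) (gT : finGroupType) (D : {group gT}) :
    1 < n -> D \isog Grp (a : b : a ^+ n = b ^+ 2 = 1, a * b = b * a^-1) ->
  exists a b, [/\ a \in D, b \in D, #[a] = n & b \notin <[a]> ]
              /\ [/\ b ^+ 2 = 1, a * b = b * a^-1 & #|D| = (n + n)%N].
Proof.
move=> n_gt1 isoD; have := isoGrp_hom isoD.
case/existsP=> -[a b] /= /eqP[defD an b2 ab]; exists a, b.
have oD_ge : n.*2 <= #|D|.
  suffices: [set: 'D_n.*2] \homg D.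
    by move/card_homg/dvdn_leq; rewrite cardG_gt0 card_dihedral //; apply.
  rewrite isoD; have := isoGrp_hom (Grp_dihedral n_gt1).
  case/existsP=> -[x y] /= /eqP[defxy xn y2 xy].
  apply/existsP; exists (x, y) => /=; rewrite defxy xn y2 !xpair_eqE !eqxx /=.
  by rewrite -xy conjgC.
have nab : <[b]> \subset 'N(<[a]>).
  by rewrite norms_cycle conjgE ab mulKg groupV cycle_id.
rewrite norm_joinEr // in defD.
have le_oa : #[a] <= n by rewrite dvdn_leq ?(ltnW n_gt1) // order_dvdn an.
have le_ob : #[b] <= 2 by rewrite dvdn_leq // order_dvdn b2.
(* The product set has at least [2n] elements, while [#[a] * #[b]] is at most [2n]. *)
have tiab : <[a]> :&: <[b]> = 1.
  by rewrite cardMg_TI // defD (leq_trans _ oD_ge) // -muln2 leq_mul.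
have oD : #|D| = (#[a] * #[b])%N by rewrite -defD TI_cardMg.
have oa : #[a] = n.
  apply/eqP; rewrite eqn_leq le_oa -(leq_pmul2r (isT : 0 < 2)) muln2.
  by rewrite (leq_trans oD_ge) // oD leq_mul.
have ob : #[b] = 2.
  apply/eqP; rewrite eqn_leq le_ob -(@leq_pmul2l n) ?(ltnW n_gt1) // muln2.
  by rewrite (leq_trans oD_ge) // oD oa.
have aD : a \in D by rewrite -defD (subsetP (mulG_subl _ _)) ?cycle_id.
have bD : b \in D by rewrite -defD (subsetP (mulG_subr _ _)) ?cycle_id.
split; split=> //; last by rewrite oD oa ob muln2 addnn.
apply/negP => b_a; have : b \in <[a]> :&: <[b]> by rewrite inE b_a cycle_id.
by rewrite tiab inE -order_eq1 ob.
Qed.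

End PowerAdjacency.

Local Open Scope ring_scope.

(** * Characteristic polynomials under a chosen vertex order *)

(** The two enumerations of [V] differ by one permutation, applied to both rows and columns, so its
    sign cancels. *)
Lemma det_injective_reindex (R : comNzRingType) (T : finType) (V : {set T})
    (m : nat) (f : 'I_m -> T) (F : T -> T -> R) :
    #|V| = m -> injective f -> (forall i, f i \in V) ->
  \det (\matrix_(i < #|V|, j < #|V|) F (enum_val i) (enum_val j))
    = \det (\matrix_(i < m, j < m) F (f i) (f j)).
Proof.
move=> cV; case: m / cV f => f f_inj fV.
pose r i := enum_rank_in (fV i) (f i).
have rK i : enum_val (r i) = f i by rewrite enum_rankK_in.
have r_inj : injective r.
  by move=> i j /(congr1 enum_val); rewrite !rK => /f_inj.
set A := (X in \det X = _).
have -> : \matrix_(i, j) F (f i) (f j)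
    = row_perm (perm r_inj) (col_perm (perm r_inj) A).
  by apply/matrixP => i j; rewrite !mxE !permE !rK.
rewrite row_permE col_permE !det_mulmx !det_perm odd_permV mulrCA.
by rewrite -signr_addb addbb mulr1.
Qed.

Lemma distance_char_poly_reindex (T : finType) (Gam : sgraph T) (m : nat)
    (f : 'I_m -> T) :
    #|vert Gam| = m -> injective f -> (forall i, f i \in vert Gam) ->
  distance_char_poly Gam
    = \det (\matrix_(i < m, j < m)
              (('X : {poly int}) *+ (i == j) - (gdist Gam (f i) (f j))%:R)).
Proof.
move=> cV f_inj fV.
pose F (u v : T) : {poly int} := 'X *+ (u == v) - (gdist Gam u v)%:R.
have -> : \matrix_(i < m, j < m) ('X *+ (i == j) - (gdist Gam (f i) (f j))%:R)
    = \matrix_(i < m, j < m) F (f i) (f j).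
  by apply/matrixP => i j; rewrite !mxE /F (inj_eq f_inj).
rewrite -(det_injective_reindex F cV f_inj fV); congr (\det _).
apply/matrixP => i j; rewrite !mxE /F (inj_eq enum_val_inj).
by rewrite -[Posz _]natz rmorph_nat.
Qed.

(* The characteristic matrix of a distance matrix whose first vertex is adjacent
   to all others; [A'] is the characteristic block of the other vertices. *)
Definition cone_mx (R : pzRingType) (k : nat) (x : R) (A' : 'M[R]_k) :
    'M[R]_(1 + k) :=
  block_mx x%:M (const_mx (- 1)) (const_mx (- 1)) A'.

(* Distances from a pendant neighbour of the first vertex to the others. *)
Definition pendant_row (R : pzRingType) (k : nat) : 'rV[R]_(1 + k) :=
  row_mx (const_mx 1) (const_mx 2%:R).

(* [cone_mx x A'] after attaching [m] pendant vertices to the first vertex. *)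
Definition pendant_mx (R : pzRingType) (k m : nat) (x : R) (A' : 'M[R]_k) :
    'M[R]_((1 + k) + m) :=
  let u : 'rV[R]_m := const_mx 1 in
  block_mx (cone_mx x A') (- ((pendant_row R k)^T *m u))
           (- (u^T *m pendant_row R k)) ((x + 2%:R)%:M - 2%:R *: (u^T *m u)).

(** * Determinant of a cone with pendant vertices *)

Section PendantDeterminant.

Variables (R : comNzRingType) (k m : nat) (x : R) (A' : 'M[R]_k).

Let A := cone_mx x A'.
Let c := pendant_row R k.
Let e0 : 'rV[R]_(1 + k) := row_mx 1%:M 0.
Let u : 'rV[R]_m := const_mx 1.
Let t := 2%:R * x + 1.
Let y := x + 2%:R.

Let A_col0 : A *m e0^T = col_mx x%:M (const_mx (- 1)).
Proof.
rewrite /A /cone_mx /e0 tr_row_mx trmx1 trmx0 mul_block_col.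
by rewrite !mulmx1 !mulmx0 !addr0.
Qed.

(** The central column [(x, -1, ..., -1)], doubled, cancels [(1, 2, ..., 2)] outside its first
    entry, which becomes [t = 2x + 1]. *)
Let A_col0c : c^T + 2%:R *: (A *m e0^T) = t *: e0^T.
Proof.
rewrite A_col0 /c /pendant_row /e0 !tr_row_mx trmx0 trmx1 !trmx_const.
rewrite !scale_col_mx add_col_mx; congr col_mx; apply/matrixP => i j.
  by rewrite !mxE !ord1 /= /t; ring.
by rewrite !mxE; ring.
Qed.

Let uuT : u *m u^T = m%:R%:M.
Proof.
apply/matrixP => i j; rewrite !ord1 !mxE eqxx.
under eq_bigr => l _ do rewrite !mxE mulr1.
by rewrite sumr_const card_ord.
Qed.

Let e0c : e0 *m c^T = 1%:M.
Proof.
rewrite /e0 /c /pendant_row tr_row_mx mul_row_col mul1mx mul0mx addr0.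
by apply/matrixP => i j; rewrite !ord1 !mxE eqxx.
Qed.

Let ce0 : c *m e0^T = 1%:M.
Proof. by rewrite -[LHS]trmxK trmx_mul trmxK e0c trmx1. Qed.

(* Subtracting twice the column of the centre from every pendant column makes
   the pendant block scalar. *)
Let pendant_mx_reduced :
  pendant_mx m x A' *m block_mx 1%:M (- (2%:R *: (e0^T *m u))) 0 1%:M
    = block_mx A (- (t *: (e0^T *m u))) (- (u^T *m c)) y%:M.
Proof.
rewrite /pendant_mx mulmx_block -/A -/c -/u -/y !mulmx1 !mulmx0 !addr0.
congr block_mx.
  rewrite mulmxN -scalemxAr mulmxA scalemxAl -opprD -mulmxDl.
  by rewrite [_ + c^T]addrC A_col0c -scalemxAl.
rewrite mulNmx mulmxN opprK -scalemxAr -mulmxA [c *m _]mulmxA ce0 mul1mx.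
by rewrite addrCA subrr addr0.
Qed.

Let E := y *: A - (t * m%:R) *: (e0^T *m c).

(** Scaling the upper rows by [y] before adding pendant rows avoids dividing by [y]; the price is a
    factor [y ^+ (1 + k)] in the determinant. *)
Let pendant_mx_cleared :
  block_mx y%:M (t *: (e0^T *m u)) 0 1%:M
    *m block_mx A (- (t *: (e0^T *m u))) (- (u^T *m c)) y%:M
    = block_mx E 0 (- (u^T *m c)) y%:M.
Proof.
rewrite mulmx_block !mul0mx !mul1mx !add0r; congr block_mx.
  rewrite mul_scalar_mx mulmxN -scalemxAl -mulmxA [u *m _]mulmxA uuT.
  by rewrite mul_scalar_mx -scalemxAr scalerA.
by rewrite mul_scalar_mx mul_mx_scalar scalerN addNr.
Qed.

(** Each row but the first carries a factor [y], supplied by [S]. The first row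
    [y(x, -1) - tm(1, 2)] equals [(y + 2tm)(x, -1) - t^2 m(1, 0)], because [2x - t = -1]. *)
Let det_E :
  \det E = y ^+ k * ((y + 2%:R * t * m%:R) * \det A - t ^+ 2 * m%:R * \det A').
Proof.
pose S : 'M[R]_(1 + k) := block_mx 1%:M 0 0 y%:M.
(* This is [A] with first row [(1, 0, ..., 0)], whose determinant is the minor without the
   centre. *)
pose A0 : 'M[R]_(1 + k) := block_mx 1%:M 0 (const_mx (- 1)) A'.
have row'0 (B : 'M[R]_(1, 1 + k)) (C : 'M[R]_(k, 1 + k)) :
    row' (lshift k ord0) (col_mx B C) = C.
  apply/matrixP => i j; rewrite mxE.
  have -> : lift (lshift k ord0) i = rshift 1 i by apply: val_inj.
  by rewrite col_mxEd.
have dS : \det S = y ^+ k by rewrite det_ublock det1 det_scalar mul1r.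
have dA0 : \det A0 = \det A' by rewrite det_lblock det1 mul1r.
have SA : S *m A = block_mx x%:M (const_mx (- 1))
                            (y *: const_mx (- 1)) (y *: A').
  by rewrite mulmx_block !mul1mx !mul0mx !addr0 !mul_scalar_mx !add0r.
have SA0 : S *m A0 = block_mx 1%:M 0 (y *: const_mx (- 1)) (y *: A').
  by rewrite mulmx_block !mul1mx !mul0mx !addr0 !mul_scalar_mx !add0r.
have EE : E = block_mx
   ((y + 2%:R * t * m%:R) *: x%:M + (- (t ^+ 2 * m%:R)) *: 1%:M)
   ((y + 2%:R * t * m%:R) *: const_mx (- 1))
   (y *: const_mx (- 1)) (y *: A').
  rewrite /E /A /cone_mx /c /pendant_row /e0 tr_row_mx trmx1 trmx0.
  rewrite mul_col_mx mul1mx mul0mx.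
  rewrite -[0]row_mx0 scale_col_mx !scale_row_mx scale_block_mx.
  rewrite !scaler0 [col_mx _ _]/(block_mx _ _ _ _) opp_block_mx add_block_mx.
  rewrite !oppr0 !addr0; congr block_mx; apply/matrixP => i j.
    by rewrite !mxE !ord1 /t /y /=; ring.
  by rewrite !mxE; ring.
rewrite (@determinant_multilinear _ _ E (S *m A) (S *m A0) (lshift k ord0)
  (y + 2%:R * t * m%:R) (- (t ^+ 2 * m%:R))).
- by rewrite !det_mulmx dS dA0; ring.
- rewrite EE SA SA0 /block_mx !rowKu !row_id !scale_row_mx add_row_mx.
  by rewrite scaler0 addr0.
- by rewrite EE SA /block_mx !row'0.
- by rewrite EE SA0 /block_mx !row'0.
Qed.

(** Powers of [x + 2] stay uncancelled on both sides because [R] need not be a domain. *)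
Lemma det_pendant_mx :
  (x + 2%:R) ^+ (1 + k) * \det (pendant_mx m x A')
    = (x + 2%:R) ^+ m * ((x + 2%:R) ^+ k
        * ((x + 2%:R + 2%:R * (2%:R * x + 1) * m%:R) * \det (cone_mx x A')
           - (2%:R * x + 1) ^+ 2 * m%:R * \det A')).
Proof.
have := congr1 determinant pendant_mx_cleared.
rewrite -pendant_mx_reduced !det_mulmx.
rewrite !det_ublock det_lblock !det_scalar det_E !expr1n !mulr1.
by move=> ->; rewrite mulrC.
Qed.

End PendantDeterminant.

(** * The dihedral power graph as a cone with pendant vertices *)

Theorem theorem3p5 (n : nat) (hn : (3 <= n)%N)
    (dT : finGroupType) (D : {group dT})
    (hD : (D \isog Grp (a : b : a ^+ n = b ^+ 2 = 1, a * b = b * a^-1))%g)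
    (zT : finGroupType) (Z : {group zT})
    (hZ : cyclic Z) (hZn : #|Z| = n) :
  distance_char_poly (power_graph D) =
    ('X + 2%:R) ^+ (n - 1) *
      (((4 * n + 1)%N%:R * 'X + (2 * (n + 1))%N%:R)
          * distance_char_poly (power_graph Z)
       - n%:R * (2%:R * 'X + 1) ^+ 2
          * distance_char_poly (proper_power_graph Z)).
Proof.
have [z defZ] := cyclicP hZ.
have oz : #[z]%g = n by rewrite orderE -defZ.
have zZ i : (z ^+ i)%g \in Z by rewrite defZ mem_cycle.
have [a [b [[aD bD oa b_a] [b2 ab oD]]]] := dihedral_generators (ltnW hn) hD.
case: n => [//|k] in hn hD hZn oz oa oD *.
have expg_eq (gT : finGroupType) (x : gT) (i j : nat) : #[x]%g = k.+1 ->
    (i < k.+1)%N -> (j < k.+1)%N -> ((x ^+ i == x ^+ j) = (i == j))%g.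
  by move=> ox lti ltj; rewrite eq_expg_mod_order ox !modn_small.
pose d i j := gdist (power_graph Z) (z ^+ i)%g (z ^+ j)%g.
have dE i j : (i < k.+1)%N -> (j < k.+1)%N ->
    d i j = (if i == j then 0
             else if power_adj (z ^+ i)%g (z ^+ j)%g then 1 else 2)%N.
  by move=> lti ltj; rewrite /d gdist_power_graph // expg_eq.
(* The shifted exponents [1, ..., k] run over the non-identity elements of [Z]. *)
pose A' : 'M[{poly int}]_k :=
  \matrix_(i < k, j < k) ('X *+ (i == j) - (d i.+1 j.+1)%:R).
have cone_mxE : cone_mx 'X A'
    = \matrix_(i < 1 + k, j < 1 + k) ('X *+ (i == j) - (d i j)%:R).
  have d0 (j : 'I_k) : d 0%N j.+1 = 1%N.
    rewrite dE ?ltnS // expg0 power_adj_sym power_adj1 //.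
    by rewrite -[1%g](expg0 z) expg_eq ?ltnS.
  apply/matrixP => i j; rewrite [RHS]mxE.
  case: (split_ordP i) => i' ->; case: (split_ordP j) => j' ->.
  - by rewrite block_mxEul !ord1 mxE !eqxx mulr1n dE //= subr0.
  - by rewrite block_mxEur mxE eq_lrshift mulr0n sub0r !ord1 /= add1n d0.
  - rewrite block_mxEdl mxE eq_rlshift mulr0n sub0r !ord1 /= add1n.
    by rewrite /d gdist_power_graphC // -/(d _ _) d0.
  - by rewrite block_mxEdr mxE eq_rshift.
have charZ : distance_char_poly (power_graph Z) = \det (cone_mx 'X A').
  pose g (i : 'I_(1 + k)) := (z ^+ i)%g.
  rewrite cone_mxE (@distance_char_poly_reindex _ _ _ g) //.
  - by move=> i j /eqP; rewrite expg_eq // => /eqP/val_inj.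
  - by move=> i; apply: zZ.
have charZ' : distance_char_poly (proper_power_graph Z) = \det A'.
  have zZ1 (i : 'I_k) : (z ^+ i.+1)%g \in (Z :\ 1)%g.
    by rewrite !inE zZ andbT -[1%g](expg0 z) expg_eq ?ltnS.
  rewrite (@distance_char_poly_reindex _ _ k (fun i : 'I_k => z ^+ i.+1)%g) /=.
  - congr (\det _); apply/matrixP => i j.
    by rewrite !mxE gdist_proper_power_graph.
  - rewrite (setIidPr (subD1set _ _)).
    by move: hZn; rewrite (cardsD1 1%g) group1 => -[].
  - by move=> i j /eqP; rewrite expg_eq ?ltnS // => /eqP[/val_inj].
  - by move=> i; rewrite inE zZ zZ1.
(* Rotations come first, starting with the identity, then the reflections; this order produces the
   blocks of [pendant_mx]. *)
pose f (i : 'I_((1 + k) + (1 + k))) : dT :=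
  match split i with inl j => (a ^+ j)%g | inr j => (b * a ^+ j)%g end.
have fl j : f (lshift _ j) = (a ^+ j)%g by rewrite /f (unsplitK (inl j)).
have fr j : f (rshift _ j) = (b * a ^+ j)%g by rewrite /f (unsplitK (inr j)).
have baN i : (b * a ^+ i)%g \notin <[a]>%g by rewrite groupMr ?mem_cycle.
have ba2 i : ((b * a ^+ i) ^+ 2 = 1)%g.
  have bab : (a ^ b = a^-1)%g by rewrite conjgE ab mulKg.
  rewrite expgS expg1 -mulgA (mulgA _ b) (conjgC _ b) conjXg bab expgVn.
  by rewrite mulgKV -[X in (X * _)%g]expg1 -expgSr b2.
have ba_neq (i j : 'I_(1 + k)) : (a ^+ i == b * a ^+ j)%g = false.
  by apply: contraNF (baN j) => /eqP <-; rewrite mem_cycle.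
have f_inj : injective f.
  move=> i j; case: (split_ordP i) => i' ->; case: (split_ordP j) => j' ->.
  - by rewrite !fl => /eqP; rewrite expg_eq // => /eqP/val_inj ->.
  - by rewrite fl fr => /eqP; rewrite ba_neq.
  - by rewrite fl fr => /esym/eqP; rewrite ba_neq.
  - by rewrite !fr => /mulgI/eqP; rewrite expg_eq // => /eqP/val_inj ->.
have fD i : f i \in D.
  by case: (split_ordP i) => j ->; rewrite ?fl ?fr ?groupM ?groupX.
have charD :
    distance_char_poly (power_graph D) = \det (pendant_mx (1 + k) 'X A').
  rewrite (@distance_char_poly_reindex _ (power_graph D) _ f oD f_inj fD).
  congr (\det _).
  have rowE (i : 'I_(1 + k)) :
      pendant_row {poly int} k ord0 i = if i == 0 :> nat then 1 else 2%:R.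
    by case: (split_ordP i) => j ->; rewrite ?row_mxEl ?row_mxEr mxE ?ord1.
  have dist_ba_a (i j : 'I_(1 + k)) :
      gdist (power_graph D) (b * a ^+ i)%g (a ^+ j)%g
        = if j == 0 :> nat then 1%N else 2%N.
    rewrite gdist_power_graph ?groupM ?groupX // eq_sym ba_neq.
    rewrite power_adj_involution ?ba2 //.
    + by rewrite -[1%g](expg0 a) expg_eq.
    + by rewrite eq_sym ba_neq.
    + apply: contra (baN i); apply: subsetP.
      by rewrite cycle_subG mem_cycle.
  have dist_ba_ba (i j : 'I_(1 + k)) :
      gdist (power_graph D) (b * a ^+ i)%g (b * a ^+ j)%g
        = if i == j then 0%N else 2%N.
    rewrite gdist_power_graph ?groupM ?groupX // (inj_eq (mulgI b)).
    rewrite expg_eq // val_eqE.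
    have [//|ij] := eqVneq i j; have v1 : (b * a ^+ j != 1)%g.
      by apply: contraNneq (baN j) => ->; rewrite group1.
    have uv : (b * a ^+ i != b * a ^+ j)%g.
      by rewrite (inj_eq (mulgI b)) expg_eq.
    rewrite power_adj_involution ?ba2 ?(negPf v1) //.
    (* A reflection generates only itself and [1], so no other reflection lies in its cycle. *)
    rewrite cycle2g ?(@nt_prime_order _ 2) ?ba2 // !inE (negPf uv) orbF.
    by apply: contraNneq (baN i) => ->; rewrite group1.
  apply/matrixP => i j; rewrite [LHS]mxE.
  case: (split_ordP i) => i' ->; case: (split_ordP j) => j' ->.
  - rewrite block_mxEul cone_mxE mxE !fl eq_lshift dE //.
    rewrite gdist_power_graph ?groupX // expg_eq //.
    by rewrite (power_adj_same_order _ _ (etrans oa (esym oz))).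
  - rewrite block_mxEur fl fr eq_lrshift mulr0n sub0r.
    rewrite gdist_power_graphC ?groupM ?groupX //.
    rewrite dist_ba_a 2!mxE big_ord1 mxE rowE mxE mulr1.
    by case: ifP.
  - rewrite block_mxEdl fl fr eq_rlshift mulr0n sub0r dist_ba_a.
    rewrite 2!mxE big_ord1 rowE !mxE mul1r.
    by case: ifP.
  - rewrite block_mxEdr !fr eq_rshift dist_ba_ba !mxE big_ord1 !mxE !mulr1.
    by case: (eqVneq i' j') => _; rewrite ?mulr1n ?mulr0n; ring.
have X2_neq0 : ('X + 2%:R : {poly int}) != 0.
  by rewrite -[2%:R]polyC_natr -size_poly_eq0 size_XaddC.
have := det_pendant_mx (1 + k) 'X A'.
(* With [m = 1 + k = n] pendant vertices, the powers [('X + 2) ^+ (1 + k)] on both sides cancel over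
   the integers, leaving exponent [k = n - 1]. *)
move/(mulfI (expf_neq0 _ X2_neq0)).
rewrite charD charZ charZ' => ->; rewrite subSS subn0.
(* The first coefficient is [x + 2 + 2n(2x + 1) = (4n + 1)x + 2(n + 1)]. *)
by congr (_ * _); ring.
Qed.
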